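(* There exist a nonzero complex Hilbert space and a densely defined closed operator $T$ on it such that $D(TT^* )\cap D(T^*T)=\{0\}$, and hence $D(TT^*-T^*T)=\{0\}$.
   Context: Operators are linear maps $T$ defined on a linear subspace $D(T)$ of a Hilbert space $\mathcal H$ with values in $\mathcal H$; $T$ is closed if its graph is closed in $\mathcal H\oplus\mathcal H$. $T^*$ denotes the adjoint of a densely defined operator $T$. Products and differences have their natural domains $D(RS)=\{x\in D(S): Sx\in D(R)\}$ and $D(R-S)=D(R)\cap D(S)$. *)

(* Defs.v *)
From mathcomp Require Import all_boot all_order all_algebra.
From mathcomp Require Import sesquilinear complex.
From mathcomp Require Import boolp classical_sets reals topology normedtype.

Set Implicit Arguments.
Unset Strict Implicit.
Unset Printing Implicit Defensive.

Import Order.TTheory GRing.Theory Num.Theory.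
Import numFieldNormedType.Exports.

Local Open Scope classical_set_scope.
Local Open Scope ring_scope.

(* The inner product is linear in its first argument and conjugate-linear in
   the second; the norm takes its values in R[i], whose order is the usual
   partial order extending that of R. *)
Record hilbertType (R : realType) := HilbertType {
  hilbert_sort :> completeNormedModType R[i] ;
  inner : {dot hilbert_sort for @Num.conj R[i]} ;
  inner_normE : forall x : hilbert_sort, inner x x = `|x| ^+ 2
}.

Arguments inner {R} H : rename.

(* [opfun T] is total, but its values outside [dom T] carry no information:
   every notion below only evaluates it on [dom T]. *)
Record operator (R : realType) (H : hilbertType R) := Operator {
  dom : set H ;
  opfun :> H -> H ;
  dom0 : dom 0 ;
  domP : forall (a : R[i]) x y, dom x -> dom y -> dom (a *: x + y) ;
  opfunP : forall (a : R[i]) x y, dom x -> dom y ->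
    opfun (a *: x + y) = a *: opfun x + opfun y
}.

Section Operators.
Variables (R : realType) (H : hilbertType R).
Implicit Types (S T : operator H) (x y z : H).

Definition graph T : set (H * H) := [set p | dom T p.1 /\ p.2 = T p.1].

Definition closed_operator T : Prop := closed (graph T).

Definition densely_defined T : Prop := dense (dom T).

Lemma op0 T : T 0 = 0.
Proof.
have := opfunP (-1) (dom0 T) (dom0 T).
by rewrite !scaleN1r !addNr.
Qed.

Section Composition.
Variables S T : operator H.

Definition comp_dom : set H := [set x | dom T x /\ dom S (T x)].

Lemma comp_dom0 : comp_dom 0.
Proof. by split; rewrite ?op0; exact: dom0. Qed.

Lemma comp_domP (a : R[i]) x y :
  comp_dom x -> comp_dom y -> comp_dom (a *: x + y).
Proof.
by move=> [Tx STx] [Ty STy]; split; rewrite ?opfunP//; exact: domP.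
Qed.

Lemma comp_funP (a : R[i]) x y : comp_dom x -> comp_dom y ->
  S (T (a *: x + y)) = a *: S (T x) + S (T y).
Proof. by move=> [Tx STx] [Ty STy]; rewrite !opfunP. Qed.

Definition op_comp : operator H := @Operator R H comp_dom
  (fun x => S (T x)) comp_dom0 comp_domP comp_funP.

End Composition.

Section Difference.
Variables S T : operator H.

Definition sub_dom : set H := dom S `&` dom T.

Lemma sub_dom0 : sub_dom 0. Proof. by split; exact: dom0. Qed.

Lemma sub_domP (a : R[i]) x y : sub_dom x -> sub_dom y -> sub_dom (a *: x + y).
Proof. by move=> [Sx Tx] [Sy Ty]; split; exact: domP. Qed.

Lemma sub_funP (a : R[i]) x y : sub_dom x -> sub_dom y ->
  S (a *: x + y) - T (a *: x + y) = a *: (S x - T x) + (S y - T y).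
Proof.
by move=> [Sx Tx] [Sy Ty]; rewrite !opfunP// scalerBr opprD addrACA.
Qed.

Definition op_sub : operator H := @Operator R H sub_dom
  (fun x => S x - T x) sub_dom0 sub_domP sub_funP.

End Difference.

Section Adjoint.
Variable T : operator H.

Definition adj_rel y z : Prop := forall x, dom T x -> inner H (T x) y = inner H x z.

Definition adj_dom : set H := [set y | exists z, adj_rel y z].

Definition adj_fun y : H := xget 0 [set z | adj_rel y z].

Lemma adj_funE y : adj_dom y -> adj_rel y (adj_fun y).
Proof. by move=> [z yz]; rewrite /adj_fun; case: xgetP => [w _ //|/(_ z)]. Qed.

Lemma adj_relP (a : R[i]) x y u v :
  adj_rel x u -> adj_rel y v -> adj_rel (a *: x + y) (a *: u + v).
Proof. by move=> xu yv w Tw; rewrite !linearPr /= xu// yv. Qed.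

Lemma adj_dom0 : adj_dom 0.
Proof. by exists 0 => x _; rewrite !linear0r. Qed.

Lemma adj_domP (a : R[i]) x y : adj_dom x -> adj_dom y -> adj_dom (a *: x + y).
Proof. by move=> [u xu] [v yv]; exists (a *: u + v); exact: adj_relP. Qed.

Hypothesis denseT : densely_defined T.

Lemma dense_ortho0 z : (forall x, dom T x -> inner H x z = 0) -> z = 0.
Proof.
move=> Tz; apply/eqP/negP => /negP z0.
have nz : 0 < `|z| by rewrite normr_gt0.
have [x [zbx Tx]] := denseT (ex_intro _ z (ballxx z nz)) (ball_open z `|z|).
have zx : `|z - x| < `|z| by move: (zbx : ball z `|z| x); rewrite -ball_normE.
have : `|z - x| ^+ 2 < `|z| ^+ 2 by rewrite ltr_pXn2r// nnegrE.
have zx0 : inner H z x = 0 by rewrite hermC /= Tz// conjC0 mulr0.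
rewrite -!inner_normE hnormB /= zx0 conjC0 !(mulr0, addr0, subr0).
by rewrite gtrDl inner_normE le_gtF// exprn_ge0.
Qed.

Lemma adj_rel_uniq y z w : adj_rel y z -> adj_rel y w -> z = w.
Proof.
move=> yz yw; apply/eqP; rewrite -subr_eq0; apply/eqP/dense_ortho0 => x Tx.
by rewrite linearBr /= -yz// -yw// subrr.
Qed.

Lemma adj_funP (a : R[i]) x y : adj_dom x -> adj_dom y ->
  adj_fun (a *: x + y) = a *: adj_fun x + adj_fun y.
Proof.
move=> Tx Ty; apply: (@adj_rel_uniq (a *: x + y)).
  by apply: adj_funE; exact: adj_domP.
by apply: adj_relP; exact: adj_funE.
Qed.

Definition adjoint : operator H :=
  @Operator R H adj_dom adj_fun adj_dom0 adj_domP adj_funP.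

End Adjoint.

End Operators.

(* Main.v *)
Require Import Defs.
From HB Require Import structures.
From mathcomp Require Import all_boot all_order all_algebra.
From mathcomp Require Import sesquilinear complex.
From mathcomp Require Import boolp classical_sets functions reals topology.
From mathcomp Require Import normedtype sequences.
From mathcomp Require Import ring lra.

(** The operator [T] lives on the Hilbert space of square summable sequences,
    which is built first: inner product, norm, completeness. Write [T'] for the
    adjoint of [T]. As [D(T T')] is contained in [D(T')] and [D(T' T)] in
    [D(T)], it is enough that [D(T)] and [D(T')] meet only in [0]. Take, on its maximal
    domain,

      [(T x)_m = 4^m x_m + 2^m x_{k(m)}],  [k(m)] the 2-adic valuation of [m],

    so that [k(m) < m] when [m > 0], and every [k] is [k(m)] for infinitely
    many [m].

    - If [x] is in [D(T')], then [x_m] is [O(4^-m)]: for [m > 0] there are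
      vectors [b_m] of bounded norm with [T b_m = 4^m e_m], so [4^m x_m], which
      has the modulus of [<T b_m, x> = <b_m, T' x>], is bounded
      ([adj_dom_decay]).
    - If [x] is in [D(T)] as well, then [2^m x_{k(m)} = (T x)_m - 4^m x_m] is
      bounded; letting [m] tend to infinity with [k(m) = k] fixed gives
      [x_k = 0] ([mix_dom_adj_dom0]).

    [T] is closed because its graph is cut out by one equation between
    coordinates for each [m], and coordinates are continuous
    ([mix_op_closed]). For density ([mix_op_dense]), keep the first [M]
    coordinates of [x] and replace the others by the recursion
    [y_m = - 2^-m y_{k(m)}]: then [(T y)_m = 0] for [m >= M], so [y] is in
    [D(T)], while [y_m] is [O(2^-m)] uniformly in [M], so that [y] tends to [x]
    as [M] grows. The vectors [b_m] come from the same recursion, with [e_m] in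
    place of [x] and [M = m + 1]. *)

Set Implicit Arguments.
Unset Strict Implicit.
Unset Printing Implicit Defensive.

Import Order.TTheory GRing.Theory Num.Theory.
Import numFieldNormedType.Exports.

Local Open Scope classical_set_scope.
Local Open Scope ring_scope.

(** * The norm of a dot product *)

Section DotNorm.
Variables (C : numClosedFieldType) (U : lmodType C).
Variable form : {dot U for @Num.conj C}.
Local Notation "''[' u , v ]" := (form u v) : ring_scope.
Local Notation "''[' u ]" := '[u, u] : ring_scope.

(** Pythagoras: [u] is the orthogonal sum of [u - a *: v] and [a *: v], where
    [a *: v] is its projection on [v]. *)
Lemma dot_CauchySchwarz u v : `|'[u, v]| ^+ 2 <= '[u] * '[v].
Proof.
have [->|v0] := eqVneq v 0; first by rewrite !linear0r normr0 expr0n mulr0.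
have vv : 0 < '[v] by rewrite dnorm_gt0.
pose a := '[u, v] / '[v].
have ou : '[u - a *: v, v] = 0.
  by rewrite linearBl /= linearZl_LR /= divfK ?subrr// gt_eqF.
have uE : '[u] = '[u - a *: v] + `|a| ^+ 2 * '[v].
  rewrite -dnormZ -hnormDd ?subrK//.
  by rewrite linearZr_LR /= ou mulr0.
rewrite uE mulrDl -mulrA -expr2 -[X in `|a| ^+ 2 * X ^+ 2](gtr0_norm vv).
by rewrite -exprMn -normrM divfK ?gt_eqF// lerDr mulr_ge0// dnorm_ge0.
Qed.

Definition dotnorm u := sqrtC '[u].

Lemma dotnormD u v : dotnorm (u + v) <= dotnorm u + dotnorm v.
Proof.
rewrite -(@ler_sqr C) ?nnegrE ?addr_ge0 ?sqrtC_ge0 ?dnorm_ge0//.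
rewrite sqrrD !sqrtCK addrAC dnormD /= lerD2l.
rewrite -mulr_natr -[_ + _](divfK (negbT (pnatr_eq0 C 2))) -/('Re _).
rewrite ler_pM2r ?ltr0n// -ReE.
apply: le_trans (leif_Re_Creal _).1 _.
rewrite -(@ler_sqr C) ?nnegrE ?mulr_ge0 ?sqrtC_ge0 ?dnorm_ge0//.
by rewrite exprMn !sqrtCK dot_CauchySchwarz.
Qed.

Lemma dotnormZ a u : dotnorm (a *: u) = `|a| * dotnorm u.
Proof.
by rewrite /dotnorm dnormZ rootCMl ?exprn_ge0// sqrCK.
Qed.

Lemma dotnorm0_eq0 u : dotnorm u = 0 -> u = 0.
Proof. by move=> /eqP; rewrite sqrtC_eq0 dnorm_eq0 => /eqP. Qed.
End DotNorm.

(** * Square summable sequences *)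

Section SqSummable.
Variable R : realType.
Implicit Types (x y : nat -> R[i]) (a z w : R[i]).

(** The real and imaginary parts of the product of [z] by the conjugate of [w];
    keeping them apart makes all the series and limits below real. *)
Definition rdot z w : R :=
  complex.Re z * complex.Re w + complex.Im z * complex.Im w.
Definition idot z w : R :=
  complex.Im z * complex.Re w - complex.Re z * complex.Im w.

Lemma rdot_ge0 z : 0 <= rdot z z.
Proof. by rewrite /rdot addr_ge0 // -expr2 sqr_ge0. Qed.

Lemma idotzz z : idot z z = 0.
Proof. by rewrite /idot mulrC subrr. Qed.

Lemma rdotD_le z w : rdot (z + w) (z + w) <= 2 * rdot z z + 2 * rdot w w.
Proof.
case: z w => [a b] [c d]; rewrite /rdot /= -subr_ge0.
rewrite (_ : _ - _ = (a - c) ^+ 2 + (b - d) ^+ 2); last by ring.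
by rewrite addr_ge0 ?sqr_ge0.
Qed.

Lemma rdotZ a z : rdot (a * z) (a * z) = rdot a a * rdot z z.
Proof. by case: a z => [a b] [c d]; rewrite /rdot /=; ring. Qed.

Lemma norm_rdot_le z w : `|rdot z w| <= rdot z z + rdot w w.
Proof.
case: z w => [a b] [c d]; rewrite /rdot /= ler_norml.
have := sqr_ge0 (a - c); have := sqr_ge0 (b - d).
have := sqr_ge0 (a + c); have := sqr_ge0 (b + d).
have := sqr_ge0 a; have := sqr_ge0 b; have := sqr_ge0 c; have := sqr_ge0 d.
by rewrite !expr2 => *; apply/andP; split; nra.
Qed.

Lemma norm_idot_le z w : `|idot z w| <= rdot z z + rdot w w.
Proof.
rewrite (_ : idot z w = rdot z ('i%C * w)); last first.
  by case: z w => [a b] [c d]; rewrite /rdot /idot /=; ring.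
apply: le_trans (norm_rdot_le _ _) _; rewrite rdotZ.
by rewrite [X in _ + X * _](_ : _ = 1) ?mul1r// /rdot /= mul0r mul1r add0r.
Qed.

Definition sqsum : {pred nat -> R[i]} :=
  fun x => `[< cvgn (series (fun k => rdot (x k) (x k))) >].

Lemma sqsumP x :
  reflect (cvgn (series (fun k => rdot (x k) (x k)))) (x \in sqsum).
Proof. exact: asboolP. Qed.

Lemma sqsum_submod : submod_closed sqsum.
Proof.
split.
  apply/sqsumP; rewrite (_ : series _ = cst 0); first exact: is_cvg_cst.
  apply/funext => n; rewrite /series/= big1// => k _.
  by rewrite /rdot /= mul0r addr0.
move=> a x y /sqsumP xs /sqsumP ys; apply/sqsumP.
have h : cvgn (series ((2 * rdot a a) *: (fun k => rdot (x k) (x k)) +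
     2 *: (fun k => rdot (y k) (y k)) : nat -> R)).
  by apply: is_cvg_seriesD; apply: is_cvg_seriesZ.
apply: series_le_cvg h => k; rewrite ?rdot_ge0//.
  by rewrite addr_ge0 // mulr_ge0 ?mulr_ge0 ?rdot_ge0.
by apply: le_trans (rdotD_le _ _) _; rewrite rdotZ mulrA.
Qed.

HB.instance Definition _ := GRing.isSubmodClosed.Build _ _ sqsum sqsum_submod.

Record ell2 := Ell2 { ell2_seq :> nat -> R[i] ; ell2P : ell2_seq \in sqsum }.

HB.instance Definition _ := [isSub for ell2_seq].
HB.instance Definition _ := [Choice of ell2 by <:].
HB.instance Definition _ := [SubChoice_isSubLmodule of ell2 by <:].

End SqSummable.

(** * The inner product *)

Section Inner.
Variable R : realType.
Implicit Types (x y : ell2 R) (a : R[i]).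

Lemma ell2_cvg x : cvgn (series (fun k => rdot (x k) (x k))).
Proof. exact/sqsumP/ell2P. Qed.

(** Both series that make up the inner product converge absolutely, by this
    comparison. *)
Lemma ell2_dominated x y (u : nat -> R) :
  (forall k, `|u k| <= rdot (x k) (x k) + rdot (y k) (y k)) -> cvgn (series u).
Proof.
move=> h; apply: normed_cvg.
have hc := is_cvg_seriesD (@ell2_cvg x) (@ell2_cvg y).
apply: series_le_cvg hc => k; [exact: normr_ge0| |exact: h].
exact: (addr_ge0 (rdot_ge0 _) (rdot_ge0 _)).
Qed.

Lemma rdot_cvg x y : cvgn (series (fun k => rdot (x k) (y k))).
Proof. by apply: (@ell2_dominated x y) => k; exact: norm_rdot_le. Qed.

Lemma idot_cvg x y : cvgn (series (fun k => idot (x k) (y k))).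
Proof. by apply: (@ell2_dominated x y) => k; exact: norm_idot_le. Qed.

Definition ell2_inner x y : R[i] :=
  Complex (limn (series (fun k => rdot (x k) (y k))))
          (limn (series (fun k => idot (x k) (y k)))).

Lemma ell2_innerC x y : ell2_inner x y = Num.conj (ell2_inner y x).
Proof.
rewrite /ell2_inner; congr Complex.
  congr (limn (series _)); apply/funext => k.
  by rewrite /rdot mulrC [X in _ + X]mulrC.
rewrite -lim_seriesN; last exact: idot_cvg.
congr (limn (series _)); apply/funext => k.
by rewrite /idot [LHS]/= fctE opprB; ring.
Qed.

Lemma lim_series_comb (a b : R) (f g h : nat -> R) :
  cvgn (series f) -> cvgn (series g) -> cvgn (series h) ->
  a * limn (series f) + b * limn (series g) + limn (series h) =
  limn (series (fun k => a * f k + b * g k + h k)).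
Proof.
move=> cf cg ch.
have sZ (c : R) (u : nat -> R) : cvgn (series u) ->
    c * limn (series u) = limn (series (c *: u)).
  by move=> cu; rewrite lim_seriesZ.
have caf : cvgn (series (a *: f)) by exact: is_cvg_seriesZ.
have cbg : cvgn (series (b *: g)) by exact: is_cvg_seriesZ.
by rewrite !sZ// -lim_seriesD// -lim_seriesD//; exact: is_cvg_seriesD.
Qed.

Lemma ell2_inner_linear y : GRing.linear_for *%R (ell2_inner^~ y).
Proof.
move=> [a b] u v; apply/eqP; rewrite eq_complex /= -mulNr.
have ru := @rdot_cvg u y; have iu := @idot_cvg u y.
have rv := @rdot_cvg v y; have iv := @idot_cvg v y.
rewrite !lim_series_comb//.
apply/andP; split; apply/eqP; congr (limn (series _)); apply/funext => k.
- transitivity (rdot (Complex a b * u k + v k) (y k)); first by [].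
  by case: (u k) (v k) (y k) => [? ?] [? ?] [? ?]; rewrite /rdot /idot /=; ring.
- transitivity (idot (Complex a b * u k + v k) (y k)); first by [].
  by case: (u k) (v k) (y k) => [? ?] [? ?] [? ?]; rewrite /rdot /idot /=; ring.
Qed.

Lemma ell2_inner_bilinear :
  bilinear_for *%R (@Num.conj R[i] \; *%R) ell2_inner.
Proof.
split; first exact: ell2_inner_linear.
move=> x a u v.
transitivity (Num.conj (a * ell2_inner u x + ell2_inner v x)).
  by rewrite -ell2_inner_linear -ell2_innerC.
by rewrite rmorphD rmorphM /= -!ell2_innerC.
Qed.

Lemma ell2_innerxx x :
  ell2_inner x x = (limn (series (fun k => rdot (x k) (x k))))%:C%C.
Proof.
rewrite /ell2_inner; congr Complex.
rewrite (_ : series _ = cst 0) ?lim_cst//.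
by apply/funext => n; rewrite /series/= big1// => k _; rewrite idotzz.
Qed.

Lemma ell2_partial_le x n :
  \sum_(0 <= k < n) rdot (x k) (x k) <=
  limn (series (fun k => rdot (x k) (x k))).
Proof.
apply: (nondecreasing_cvgn_le _ (@ell2_cvg x) n).
by apply/nondecreasing_series => k _ _; exact: rdot_ge0.
Qed.

Lemma rdot_coord_le x k :
  rdot (x k) (x k) <= limn (series (fun k => rdot (x k) (x k))).
Proof.
apply: le_trans (@ell2_partial_le x k.+1).
by rewrite big_nat_recr//= lerDr sumr_ge0 // => i _; exact: rdot_ge0.
Qed.

Lemma rdot_eq0 (z : R[i]) : rdot z z = 0 -> z = 0.
Proof.
case: z => a b; rewrite /rdot /= => /eqP; rewrite paddr_eq0 -?expr2 ?sqr_ge0//.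
by rewrite !sqrf_eq0 => /andP[/eqP -> /eqP ->].
Qed.

Lemma eq_ell2 x y : x =1 y :> (nat -> R[i]) -> x = y.
Proof. by move=> xy; apply/val_inj/funext. Qed.

Lemma ell2_inner_gt0 x : x != 0 -> 0 < ell2_inner x x.
Proof.
move=> x0; rewrite ell2_innerxx ltcR lt_neqAle eq_sym.
apply/andP; split; last first.
  by apply: le_trans (rdot_coord_le x 0); exact: rdot_ge0.
apply: contra x0 => /eqP q0; apply/eqP/eq_ell2 => k; apply: rdot_eq0.
by apply/eqP; rewrite eq_le rdot_ge0 -{1}q0 rdot_coord_le.
Qed.

HB.instance Definition _ := bilinear_isBilinear.Build _ _ _ _ _ _
  ell2_inner ell2_inner_bilinear.
HB.instance Definition _ := isHermitianSesquilinear.Build _ _ false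
  (@Num.conj R[i]) ell2_inner
  (fun x y => etrans (ell2_innerC x y) (esym (mul1r _))).
HB.instance Definition _ := isDotProduct.Build _ _ ell2_inner ell2_inner_gt0.

HB.instance Definition _ := Lmodule_isNormed.Build R[i] (ell2 R)
  (@dotnormD _ _ ell2_inner) (@dotnormZ _ _ ell2_inner)
  (@dotnorm0_eq0 _ _ ell2_inner).

Lemma ell2_normE x : ell2_inner x x = `|x| ^+ 2.
Proof. by rewrite sqrtCK. Qed.
End Inner.

(** * Completeness *)

Section Complete.
Variable R : realType.
Local Notation E := (ell2 R).
Implicit Types x y : E.

Lemma rdot_norm (z : R[i]) : (rdot z z)%:C%C = `|z| ^+ 2.
Proof. by rewrite -add_Re2_Im2 /rdot !expr2. Qed.

Lemma partial_le_norm x n :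
  (\sum_(0 <= k < n) rdot (x k) (x k))%:C%C <= `|x| ^+ 2.
Proof. by rewrite -ell2_normE ell2_innerxx lecR ell2_partial_le. Qed.

Lemma coord_le_norm x k : `|x k| <= `|x|.
Proof.
rewrite -(@ler_pXn2r _ 2)// ?nnegrE// -ell2_normE ell2_innerxx -rdot_norm lecR.
exact: rdot_coord_le.
Qed.

Lemma dist_coord x y k : `|x k - y k| <= `|x - y|.
Proof. exact: (coord_le_norm (x - y) k). Qed.

Lemma Re_dist x y k :
  `|complex.Re (x k) - complex.Re (y k)|%:C%C <= `|x - y|.
Proof.
apply: le_trans (dist_coord x y k); apply: le_trans (normc_ge_Re _).
by rewrite raddfB.
Qed.

Lemma Im_dist x y k :
  `|complex.Im (x k) - complex.Im (y k)|%:C%C <= `|x - y|.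
Proof.
apply: le_trans (dist_coord x y k); rewrite -raddfB /=.
case: (x k - y k) => a b /=; rewrite normc_def lecR /= -sqrtr_sqr.
by rewrite ler_sqrt ?addr_ge0 ?sqr_ge0// lerDr sqr_ge0.
Qed.

Lemma sqsum_bounded (y : nat -> R[i]) (B : R) :
  (forall n, \sum_(0 <= k < n) rdot (y k) (y k) <= B) -> y \in @sqsum R.
Proof.
move=> yB; apply/sqsumP; apply: nondecreasing_is_cvgn.
  by apply/nondecreasing_series => k _ _; exact: rdot_ge0.
by exists B => _ [n _ <-]; exact: yB.
Qed.

Lemma norm_le_bound x (B : R) : 0 <= B ->
  (forall n, \sum_(0 <= k < n) rdot (x k) (x k) <= B ^+ 2) -> `|x| <= B%:C%C.
Proof.
move=> B0 xB; rewrite -(@ler_pXn2r _ 2)// ?nnegrE ?ler0c//.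
rewrite -ell2_normE ell2_innerxx -rmorphXn /= lecR.
apply: limr_le; first exact: ell2_cvg.
by apply: nearW => n; exact: xB.
Qed.

Lemma gt0_complexE (e : R[i]) :
  0 < e -> e = (complex.Re e)%:C%C /\ 0 < complex.Re e.
Proof. by case: e => a b; rewrite ltcE /= => /andP[/eqP-> a0]. Qed.

(** A Cauchy filter converges coordinatewise to some [l]. A ball of radius [e]
    around [x] that belongs to the filter bounds each partial sum of the squared
    distance from [x] to its members by [e ^+ 2]; a partial sum depends on
    finitely many coordinates, so the bound passes to [l]. Hence [l] is square
    summable and within [e] of [x]. *)
Lemma ell2_complete (F : set_system E) : ProperFilter F -> cauchy F -> cvg F.
Proof.
move=> FF /cauchyP Fc.
have Fc' e : 0 < e -> exists x, F [set y | `|x - y| < e%:C%C].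
  move=> e0; have /Fc[x] : 0 < e%:C%C by rewrite ltcR.
  by rewrite -ball_normE => ?; exists x.
have cRe k : cvg ((fun x : E => complex.Re (x k)) @ F).
  apply: cauchy_cvg; apply: cauchy_exP => e /Fc'[x Fx].
  exists (complex.Re (x k)); apply: (filterS (F := F)) Fx => y /= xy.
  rewrite -ball_normE /= -ltcR; apply: le_lt_trans xy.
  exact: Re_dist.
have cIm k : cvg ((fun x : E => complex.Im (x k)) @ F).
  apply: cauchy_cvg; apply: cauchy_exP => e /Fc'[x Fx].
  exists (complex.Im (x k)); apply: (filterS (F := F)) Fx => y /= xy.
  rewrite -ball_normE /= -ltcR; apply: le_lt_trans xy.
  exact: Im_dist.
pose l k : R[i] := Complex (lim ((fun x : E => complex.Re (x k)) @ F))
                           (lim ((fun x : E => complex.Im (x k)) @ F)).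
have lx e x n : 0 < e -> F [set y | `|x - y| < e%:C%C] ->
    \sum_(0 <= k < n) rdot (l k - x k) (l k - x k) <= e ^+ 2.
  move=> e0 Fx.
  apply: (@cvgr_to_le _ F _ _ (fun y : E =>
    \sum_(0 <= k < n) rdot (y k - x k) (y k - x k))); last first.
    apply: filterS Fx => y /= xy; rewrite -lecR.
    apply: le_trans (partial_le_norm (y - x) n) _.
    rewrite rmorphXn /= -normrN opprB ler_pXn2r ?nnegrE ?ler0c ?(ltW e0)//.
    exact: ltW.
  apply: cvg_big => [|k _]; first exact: add_continuous.
  have cr : (fun y => complex.Re (y k - x k)) @ F --> complex.Re (l k - x k).
    rewrite raddfB /=; under eq_fun do rewrite raddfB /=.
    by apply: cvgB; [exact: cRe|exact: cvg_cst].
  have ci : (fun y => complex.Im (y k - x k)) @ F --> complex.Im (l k - x k).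
    rewrite raddfB /=; under eq_fun do rewrite raddfB /=.
    by apply: cvgB; [exact: cIm|exact: cvg_cst].
  by apply: cvgD; apply: cvgM.
have ls : l \in @sqsum R.
  have [x Fx] := Fc' 1 ltr01.
  have h : (fun k => l k - x k) \in @sqsum R.
    by apply: (@sqsum_bounded _ (1 ^+ 2)) => n; exact: lx Fx.
  rewrite (_ : l = (fun k => l k - x k) + x); first by rewrite rpredD ?ell2P.
  by apply/funext => k; rewrite fctE subrK.
apply/cvg_ex; exists (Ell2 ls).
apply/cvg_ballP => e /gt0_complexE[-> e0].
have [x Fx] := Fc' _ (divr_gt0 e0 (ltr0n _ 2)).
apply: filterS (Fx) => y /= xy.
rewrite -ball_normE /= -(subrKA x).
apply: le_lt_trans (ler_normD _ _) _.
rewrite [X in X%:C%C]splitr rmorphD /= ler_ltD//.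
apply: norm_le_bound; first by rewrite ltW ?divr_gt0.
by move=> n; apply: lx Fx; rewrite divr_gt0.
Qed.

HB.instance Definition _ := Uniform_isComplete.Build E ell2_complete.

Definition ell2_hilbert : hilbertType R :=
  @HilbertType R E (@ell2_inner R) (@ell2_normE R).
End Complete.

(** * The infinite matrix and its recursive solutions *)

Section Sequences.
Variable R : realType.
Implicit Types (x y : nat -> R[i]).

(** The factor [4 ^+ m] forces decay on the vectors of the adjoint domain; the
    second term mixes in a coordinate of small index with a weight [2 ^+ m]
    that is unbounded, and yet small enough against [4 ^+ m] for the equation
    [mix x m = 0] to have small solutions. *)
Definition mix x : nat -> R[i] :=
  fun m => 4 ^+ m * x m + 2 ^+ m * x (logn 2 m).

Lemma mix_linear (a : R[i]) x y : mix (a *: x + y) = a *: mix x + mix y.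
Proof.
apply/funext => m; rewrite /mix !fctE /GRing.scale /= /GRing.scale /=.
by rewrite !mulrDr !mulrA !(mulrC a) addrACA.
Qed.

Lemma sqsum_finite x M : (forall m, (M <= m)%N -> x m = 0) -> x \in @sqsum R.
Proof.
pose q k := rdot (x k) (x k).
move=> xM; apply: (@sqsum_bounded _ _ (\sum_(0 <= k < M) q k)) => n.
have homo : {homo series q : a b / (a <= b)%N >-> a <= b}.
  by apply/nondecreasing_series => k _ _; exact: rdot_ge0.
apply: le_trans (homo _ _ (leq_maxl n M)) _.
rewrite -subr_le0 -[X in _ - X]/(series _ M) sub_series_geq ?leq_maxr//.
rewrite big_nat_cond big1// => k /andP[/andP[/xM xk _] _].
by rewrite /q xk /rdot /= mulr0 addr0.
Qed.

(** Bounds a squared distance that only involves coordinates from [M] on by the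
    tail of a series fixed in advance: small when [M] is large, and at most the
    total sum for every [M]. *)
Lemma sum_le_tail (d u : nat -> R) (M n : nat) :
  (forall k, 0 <= d k) -> (forall k, 0 <= u k) -> cvgn (series u) ->
  (forall k, (k < M)%N -> d k = 0) -> (forall k, (M <= k)%N -> d k <= u k) ->
  \sum_(0 <= k < n) d k <= limn (series u) - series u M.
Proof.
move=> d0 u0 cu dM du.
have homo : {homo series d : a b / (a <= b)%N >-> a <= b}.
  by apply/nondecreasing_series.
apply: le_trans (homo _ _ (leq_maxl n M)) _.
have -> : series d (maxn n M) = \sum_(M <= k < maxn n M) d k.
  rewrite -sub_series_geq ?leq_maxr// [X in _ - X](_ : _ = 0) ?subr0//.
  by rewrite /series/= big_nat_cond big1// => k /andP[/andP[_ /dM]].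
apply: (@le_trans _ _ (\sum_(M <= k < maxn n M) u k)).
  rewrite big_nat_cond [leRHS]big_nat_cond.
  by apply: ler_sum => k /andP[/andP[/du]].
rewrite -sub_series_geq ?leq_maxr// lerD2r.
apply: nondecreasing_cvgn_le => //.
by apply/nondecreasing_series.
Qed.

(** The recursive call is at [logn 2 m], not at the predecessor of [m], so the
    recursion is carried by a separate bound [n] on its depth; [n = m] is
    enough as soon as [0 < M], by [extend_fuelE]. *)
Fixpoint extend_fuel M x n m : R[i] :=
  if n is n'.+1 then
    if (m < M)%N then x m else - 2 ^- m * extend_fuel M x n' (logn 2 m)
  else x m.

Definition extend M x m := extend_fuel M x m m.

Lemma extend_fuelE M x n m : (0 < M)%N -> (m <= n)%N ->
  extend_fuel M x n m = extend M x m.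
Proof.
move=> M0; elim/ltn_ind: m n => -[|m] IH [|n]//= mn; first by rewrite M0.
rewrite /extend /=; case: ifP => // _.
have km := @ltn_logl 2 m.+1 isT.
by rewrite !IH//; exact: (leq_trans km mn).
Qed.

Lemma extend_lt M x m : (m < M)%N -> extend M x m = x m.
Proof. by case: m => [|m] mM; rewrite /extend /= ?mM. Qed.

Lemma extend_ge M x m : (0 < M)%N -> (M <= m)%N ->
  extend M x m = - 2 ^- m * extend M x (logn 2 m).
Proof.
move=> M0; case: m => [|m] Mm; first by rewrite leqNgt M0 in Mm.
rewrite {1}/extend /= ltnNge Mm /= extend_fuelE//.
exact: (@ltn_logl 2 m.+1).
Qed.

Lemma mix_extend M x m : (0 < M)%N -> (M <= m)%N -> mix (extend M x) m = 0.
Proof.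
move=> M0 Mm; rewrite /mix extend_ge// mulrA mulrN -mulrDl.
rewrite (_ : 4 = 2 ^+ 2 :> R[i]); last by rewrite -natrX.
by rewrite -exprM mul2n -addnn exprD mulfK ?addNr ?mul0r// expf_neq0 ?pnatr_eq0.
Qed.

Lemma norm_extend_le M x (K : R[i]) m : (0 < M)%N ->
  (forall j, `|x j| <= K) -> `|extend M x m| <= K.
Proof.
move=> M0 xK; elim/ltn_ind: m => m IH.
have [mM|Mm] := ltnP m M; first by rewrite extend_lt.
rewrite extend_ge// normrM normrN normfV normrX normr_nat.
apply: le_trans (IH _ (@ltn_logl 2 m (leq_trans M0 Mm))).
by rewrite ler_piMl// invf_le1 ?exprn_gt0// exprn_ege1// ler1n.
Qed.

Lemma rdot_extend_le M x (K : R) m : (0 < M)%N -> (M <= m)%N ->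
  (forall j, `|x j| <= K%:C%C) ->
  rdot (extend M x m) (extend M x m) <= K ^+ 2 * 4^-1 ^+ m.
Proof.
move=> M0 Mm xK.
have K0 : 0 <= K by rewrite -ler0c; exact: le_trans (xK 0).
rewrite -lecR rdot_norm extend_ge// normrM normrN normfV normrX normr_nat.
rewrite exprMn rmorphM !rmorphXn /= fmorphV rmorph_nat mulrC.
have -> : (2 ^- m) ^+ 2 = 4^-1 ^+ m :> R[i].
  by rewrite -exprVn -exprM mulnC exprM exprVn -natrX.
rewrite ler_pM2r.
  by rewrite ler_pXn2r ?nnegrE ?normr_ge0 ?ler0c// norm_extend_le.
by rewrite exprn_gt0// invr_gt0.
Qed.

Lemma geometric4_cvg (K : R) : cvgn (series (fun k => K * 4^-1 ^+ k)).
Proof.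
apply: is_cvg_geometric_series.
by rewrite ger0_norm ?invr_ge0// invf_lt1 ?ltr1n.
Qed.

End Sequences.

(** * The operator: maximal domain, closedness, density *)

Section Operator.
Variable R : realType.
Local Notation E := (ell2 R).
Implicit Types x y : E.

Lemma rdotB_le (z w : R[i]) :
  rdot (z - w) (z - w) <= 2 * rdot z z + 2 * rdot w w.
Proof.
apply: le_trans (rdotD_le _ _) _; rewrite lerD2l.
by case: w => a b; rewrite /rdot /= !mulrNN.
Qed.

(** As [extend M x] and [x] agree below [M] and are both dominated beyond, the
    former is square summable and converges to the latter as [M] grows; what
    matters is that the dominating series [u] does not depend on [M]. *)
Lemma extend_tail x :
  exists2 u : nat -> R, cvgn (series u) & forall M, (0 < M)%N ->
  exists2 y : E, (y : nat -> R[i]) = extend M x &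
    forall n, \sum_(0 <= k < n) rdot (y k - x k) (y k - x k) <=
      limn (series u) - series u M.
Proof.
pose K := complex.Re `|x|.
have xK j : `|x j| <= K%:C%C.
  apply: le_trans (coord_le_norm x j) _.
  by rewrite /K RRe_real // ger0_real.
pose u : nat -> R := fun k => 2 * K ^+ 2 * 4^-1 ^+ k + 2 * rdot (x k) (x k).
have cu : cvgn (series u).
  apply: (is_cvg_seriesD (@geometric4_cvg R (2 * K ^+ 2))).
  by apply: is_cvg_seriesZ; exact: ell2_cvg.
have u0 k : 0 <= u k.
  apply: addr_ge0; last by rewrite mulr_ge0 ?rdot_ge0.
  by apply: mulr_ge0; [rewrite mulr_ge0 ?sqr_ge0|rewrite exprn_ge0 ?invr_ge0].
exists u => // M M0.
have tail n :
    \sum_(0 <= k < n) rdot (extend M x k - x k) (extend M x k - x k) <=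
    limn (series u) - series u M.
  apply: sum_le_tail => // k; first exact: rdot_ge0.
    by move=> kM; rewrite extend_lt// subrr /rdot /= mulr0 addr0.
  move=> Mk; apply: le_trans (rdotB_le _ _) _.
  by rewrite lerD2r -mulrA ler_pM2l// rdot_extend_le.
have ds : (fun k => extend M x k - x k) \in @sqsum R.
  exact: sqsum_bounded tail.
have es : extend M x \in @sqsum R.
  rewrite (_ : extend M x = (fun k => extend M x k - x k) + x); last first.
    by apply/funext => k; rewrite fctE subrK.
  by rewrite rpredD ?ell2P.
by exists (Ell2 es).
Qed.

Definition mix_dom : set E := [set x | mix x \in @sqsum R].
Definition mix_fun x : E := insubd (0 : E) (mix x).

Lemma mix_funE x : mix_dom x -> (mix_fun x : nat -> R[i]) = mix x.
Proof. by move=> xd; exact: insubdK. Qed.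

Lemma mix_dom0 : mix_dom 0.
Proof.
rewrite /mix_dom /= (_ : mix _ = 0) ?rpred0//.
by apply/funext => m; rewrite /mix !mulr0 addr0.
Qed.

Lemma mix_domP (a : R[i]) x y : mix_dom x -> mix_dom y -> mix_dom (a *: x + y).
Proof.
rewrite /mix_dom /= => xd yd.
rewrite (_ : mix _ = a *: mix x + mix y); last exact: mix_linear.
by rewrite rpredD// rpredZ.
Qed.

Lemma mix_funP (a : R[i]) x y : mix_dom x -> mix_dom y ->
  mix_fun (a *: x + y) = a *: mix_fun x + mix_fun y.
Proof.
move=> xd yd; apply/val_inj; rewrite /= mix_funE; last exact: mix_domP.
transitivity (a *: mix x + mix y); first exact: mix_linear.
by rewrite -!mix_funE.
Qed.

Definition mix_op : operator (ell2_hilbert R) :=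
  @Operator R (ell2_hilbert R) mix_dom mix_fun mix_dom0 mix_domP mix_funP.

Lemma coord_continuous k : continuous (fun x : E => x k : R[i]^o).
Proof.
move=> x; have FF : Filter (nbhs (x : E)) by exact: nbhs_filter.
apply/(@cvgrPdist_lt _ _ _ (nbhs (x : E)) FF) => e e0.
apply: filterS (nbhsx_ballx x e e0) => y.
by rewrite -ball_normE; exact: le_lt_trans (dist_coord x y k).
Qed.

Lemma mix_op_closed : closed_operator mix_op.
Proof.
rewrite /closed_operator.
have -> : graph mix_op = \bigcap_(m in setT)
    ((fun p : E * E => mix p.1 m - p.2 m : R[i]^o) @^-1` [set 0]).
  apply/seteqP; split => -[x y] /=.
    by move=> [/= xd ->] m _ /=; rewrite mix_funE ?subrr.
  move=> xy.
  have yE : mix x = y by apply/funext => m; exact: subr0_eq (xy m Logic.I).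
  have xd : mix_dom x by rewrite /mix_dom /= yE ell2P.
  by split => //; apply/val_inj; rewrite /= mix_funE.
apply: closed_bigI => m _; apply: preimage_closed; last first.
  exact/accessible_closed_set1/hausdorff_accessible/norm_hausdorff.
move=> p _.
have c1 k : {for p, continuous (fun p : E * E => p.1 k : R[i]^o)}.
  apply: (@continuous_comp _ _ _ fst (fun x : E => x k : R[i]^o)).
    exact: cvg_fst.
  exact: coord_continuous.
have c2 k : {for p, continuous (fun p : E * E => p.2 k : R[i]^o)}.
  apply: (@continuous_comp _ _ _ snd (fun x : E => x k : R[i]^o)).
    exact: cvg_snd.
  exact: coord_continuous.
rewrite /mix; apply: cvgB; last exact: c2.
by apply: cvgD; apply: cvgM; (exact: c1 || exact: cvg_cst).
Qed.

Lemma mix_op_dense : densely_defined mix_op.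
Proof.
move=> O [x Ox] oO.
have /nbhs_ballP[e /= /gt0_complexE[-> e0] eO] : nbhs x O.
  exact: open_nbhs_nbhs.
have [u cu xu] := extend_tail x.
have : \forall M \near \oo,
    `|limn (series u) - series u M| < (complex.Re e / 2) ^+ 2.
  by apply: cvgr_dist_lt => //; rewrite exprn_gt0 ?divr_gt0.
move=> [N _ hN].
have [y yE yx] := xu N.+1 isT.
exists y; split.
  apply: eO; rewrite -ball_normE /= -normrN opprB.
  apply: (@le_lt_trans _ _ (complex.Re e / 2)%:C%C).
    apply: norm_le_bound; first by rewrite ltW// divr_gt0.
    move=> n; apply: le_trans (yx n) _; apply: le_trans (ler_norm _) _.
    by apply/ltW/hN => /=.
  by rewrite ltcR ltr_pdivrMr// ltr_pMr// ltr1n.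
rewrite /= /mix_dom /= yE; apply: (@sqsum_finite _ _ N.+1) => m Nm.
exact: mix_extend.
Qed.

End Operator.

(** * The domain of the adjoint *)

Section Adj.
Variable R : realType.
Local Notation E := (ell2 R).
Implicit Types x y : E.

Definition deltaseq (m : nat) : nat -> R[i] := fun k => (k == m)%:R.

Lemma delta_sqsum m : deltaseq m \in @sqsum R.
Proof.
apply: (@sqsum_finite _ _ m.+1) => k mk.
by rewrite /deltaseq gtn_eqF.
Qed.

Definition delta m : E := Ell2 (delta_sqsum m).

Lemma inner_delta m y : ell2_inner (delta m) y = Num.conj (y m).
Proof.
have rd k : rdot (delta m k) (y k) = if k == m then complex.Re (y m) else 0.
  rewrite /rdot /= /deltaseq.
  case: eqP => [->|_] /=; last by rewrite !mul0r addr0.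
  by rewrite mul1r mul0r addr0.
have id k : idot (delta m k) (y k) = if k == m then - complex.Im (y m) else 0.
  rewrite /idot /= /deltaseq.
  case: eqP => [->|_] /=; last by rewrite !mul0r subr0.
  by rewrite mul1r mul0r add0r.
have lim_single (u : nat -> R) c : (forall k, u k = if k == m then c else 0) ->
    limn (series u) = c.
  move=> uE; apply: lim_near_cst; first exact: norm_hausdorff.
  exists m.+1 => // n /= mn.
  rewrite /series /= (eq_bigr _ (fun k _ => uE k)) -big_mkcond big_nat1_eq /=.
  by rewrite mn.
rewrite /ell2_inner (lim_single _ _ rd) (lim_single _ _ id).
by case: (y m).
Qed.

Lemma norm_delta m : `|delta m| = 1.
Proof.
apply/eqP; rewrite -(@eqrXn2 _ 2)// -ell2_normE inner_delta /= /deltaseq eqxx.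
by rewrite conjC1 expr1n.
Qed.

(** Each of these vectors is [delta m] plus a correction whose coordinate [k] is
    at most [2 ^- k], which is why one bound [B] serves for all [m]. *)
Lemma test_vectors : exists2 B : R, 0 <= B & forall m, (0 < m)%N ->
  exists b : E, [/\ mix_dom b, mix_fun b = 4 ^+ m *: delta m & `|b| <= B%:C%C].
Proof.
pose L := limn (series (fun k => 4^-1 ^+ k : R)).
have cu : cvgn (series (fun k => 4^-1 ^+ k : R)).
  have := @geometric4_cvg R 1.
  by under [X in series X]eq_fun do rewrite mul1r.
exists (1 + Num.sqrt L); first by rewrite addr_ge0 ?sqrtr_ge0.
move=> m m0.
(* Below [m] this vanishes and at [m] it is 1; the recursion starts at [m.+1],
   so that row [m] keeps its entry [4 ^+ m]. *)
pose b := extend m.+1 (deltaseq m).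
have d1 j : `|deltaseq m j| <= 1%:C%C.
  by rewrite /deltaseq normr_nat; case: eqP; rewrite ?lexx ?ler01.
have bd n : \sum_(0 <= k < n) rdot (b k - delta m k) (b k - delta m k) <= L.
  apply: le_trans (_ : L - series (fun k => 4^-1 ^+ k : R) m.+1 <= _).
    apply: sum_le_tail => // k.
    - exact: rdot_ge0.
    - by rewrite exprn_ge0 ?invr_ge0.
    - by move=> km; rewrite /b extend_lt// subrr /rdot /= mulr0 addr0.
    - move=> mk; rewrite /delta /= /deltaseq gtn_eqF// subr0.
      by apply: le_trans (rdot_extend_le _ mk d1) _; rewrite // expr1n mul1r.
  by rewrite gerBl sumr_ge0 // => k _; rewrite exprn_ge0 ?invr_ge0.
have L0 : 0 <= L by apply: le_trans (bd 0%N); rewrite big_nil.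
have ds := sqsum_bounded bd.
have be : b = deltaseq m + (fun k => b k - delta m k).
  by apply/funext => k; rewrite fctE addrC subrK.
have bs : b \in @sqsum R by rewrite be rpredD ?delta_sqsum.
have bv : mix b = 4 ^+ m *: deltaseq m.
  apply/funext => j; rewrite fctE /GRing.scale /=.
  have [mj|jm] := ltnP m j.
    by rewrite mix_extend// /deltaseq gtn_eqF// mulr0.
  have small k : (k <= m)%N -> b k = (k == m)%:R.
    by move=> km; rewrite /b extend_lt.
  (* Row 0 is the only one whose second term is on the diagonal. *)
  have [j0|j0] := posnP j.
    rewrite /mix j0 logn0 !small// /deltaseq eq_sym.
    by rewrite eqn0Ngt m0 !mulr0 addr0.
  have kj := @ltn_logl 2 j j0.
  rewrite /mix !small//; last by rewrite ltnW// (leq_trans kj).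
  rewrite /deltaseq (ltn_eqF (leq_trans kj jm)) mulr0 addr0.
  by case: eqP => [->//|_]; rewrite !mulr0.
exists (Ell2 bs).
have bdom : mix_dom (Ell2 bs) by rewrite /mix_dom /= bv rpredZ// delta_sqsum.
split => //.
  by apply/val_inj; rewrite /= mix_funE.
have -> : Ell2 bs = delta m + Ell2 ds by apply/val_inj.
apply: le_trans (ler_normD _ _) _; rewrite rmorphD /= norm_delta lerD2l.
apply: norm_le_bound; first exact: sqrtr_ge0.
by move=> n; rewrite sqr_sqrtr.
Qed.

Lemma ell2_CauchySchwarz x y : `|ell2_inner x y| <= `|x| * `|y|.
Proof.
rewrite -(@ler_pXn2r _ 2)// ?nnegrE ?mulr_ge0//.
by rewrite exprMn -!ell2_normE; exact: dot_CauchySchwarz.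
Qed.

(** Test the relation that defines the adjoint on the vectors of
    [test_vectors], and bound the other side by Cauchy-Schwarz. *)
Lemma adj_dom_decay y : adj_dom (mix_op R) y ->
  exists2 c : R, 0 <= c & forall m, (0 < m)%N -> 4 ^+ m * `|y m| <= c%:C%C.
Proof.
move=> [z yz]; have [B B0 hB] := test_vectors.
exists (B * complex.Re `|z : E|).
  by rewrite mulr_ge0// -ler0c RRe_real ?ger0_real.
move=> m /hB[b [bd bv nb]].
have := yz b bd; rewrite /= bv => e.
have -> : 4 ^+ m * `|y m| = `|ell2_inner b z|.
  have e' : 4 ^+ m * Num.conj (y m) = ell2_inner b z.
    by rewrite -inner_delta -linearZl_LR.
  by rewrite -e' normrM normrX normr_nat norm_conjC.
apply: le_trans (ell2_CauchySchwarz _ _) _.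
rewrite rmorphM /= RRe_real ?ger0_real//.
by rewrite ler_wpM2r.
Qed.

(** The coordinate [k] occurs, with weight [2 ^+ m], in every row [m] whose
    2-adic valuation is [k]; there are such rows with [m] arbitrarily large,
    while decay and membership in the domain keep [2 ^+ m * `|x k|] bounded. *)
Lemma mix_dom_adj_dom0 x : mix_dom x -> adj_dom (mix_op R) x -> x = 0.
Proof.
move=> xd /adj_dom_decay[c c0 xc].
have bound m : (0 < m)%N -> 2 ^+ m * `|x (logn 2 m)| <= `|mix_fun x| + c%:C%C.
  move=> m0; rewrite -[2 ^+ m]ger0_norm ?exprn_ge0// -normrM.
  have -> : 2 ^+ m * x (logn 2 m) = mix_fun x m - 4 ^+ m * x m.
    by rewrite mix_funE // /mix addrC addKr.
  apply: le_trans (ler_normB _ _) _; apply: lerD; first exact: coord_le_norm.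
  by rewrite normrM normrX normr_nat; exact: xc.
apply/eq_ell2 => k; apply/eqP; rewrite -normr_eq0; apply/negP => /negP xk0.
pose t := complex.Re `|x k|; pose d := complex.Re `|mix_fun x| + c.
have t0 : 0 < t.
  by apply: (gt0_complexE _).2; rewrite lt_neqAle eq_sym xk0 normr_ge0.
pose j := Num.bound (d / t).
have : d < t * j%:R.
  rewrite mulrC -ltr_pdivrMr//; apply: archi_boundP.
  by rewrite divr_ge0 ?(ltW t0)// addr_ge0// -ler0c RRe_real ?ger0_real.
(* A row of valuation [k] with index at least [j]. *)
pose m := (2 ^ k * j.*2.+1)%N.
have m0 : (0 < m)%N by rewrite muln_gt0 expn_gt0.
have mk : logn 2 m = k.
  rewrite /m lognM ?expn_gt0// pfactorK// lognE /=.
  by rewrite dvdn2 /= odd_double /= addn0.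
have := bound m m0; rewrite mk => h.
rewrite ltNge => /negP; apply.
have h' : 2 ^+ m * t <= d.
  rewrite -lecR rmorphM rmorphD /= rmorphXn /= rmorph_nat.
  by rewrite !RRe_real ?ger0_real.
apply: le_trans h'; rewrite mulrC ler_pM2r// -natrX ler_nat.
apply: leq_trans (ltnW (ltn_expl m (isT : 1 < 2)%N)).
apply: (@leq_trans j.*2.+1); last by rewrite leq_pmull ?expn_gt0.
by rewrite -addnn ltnW// ltnS leq_addr.
Qed.

End Adj.

Theorem proposition2p6 (R : realType) :
  exists (H : hilbertType R) (T : operator H) (denseT : densely_defined T),
    let Tstar := adjoint denseT in
    [/\ exists x : H, x != 0,
        closed_operator T,
        dom (op_comp T Tstar) `&` dom (op_comp Tstar T) = [set 0] &
        dom (op_sub (op_comp T Tstar) (op_comp Tstar T)) = [set 0]].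
Proof.
exists (ell2_hilbert R), (mix_op R), (@mix_op_dense R) => Tstar.
have h : dom (op_comp (mix_op R) Tstar) `&` dom (op_comp Tstar (mix_op R)) =
    [set 0].
  apply/seteqP; split => x; last by move=> ->; split; exact: dom0.
  by move=> [[xs _] [xd _]]; exact: mix_dom_adj_dom0.
split => //; last exact: mix_op_closed.
exists (delta R 0).
by rewrite -normr_gt0 norm_delta ltr01.
Qed.
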